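(* In the unidirectional transaction stream problem without rejection (defined in the context), the deterministic online algorithm ON described in the context is $2$-competitive: for every transaction sequence $X_t$, $\mathrm{Cost}_{\mathrm{ON}}(X_t)\le 2\cdot\mathrm{Cost}_{\mathrm{OFF}}(X_t)$.
   Context: Unidirectional transaction stream without rejection. A payment channel $(\ell,r)$; user $\ell$ has balance $b$, initially $0$. A sequence $X_t=(x_1,\dots,x_t)$ of transactions of sizes $x_i\in\mathbb{R}^+$, all in the left-to-right direction, arrives one by one. Every transaction must be accepted, in order of arrival: accepting $x$ requires $b\ge x$ and decreases $b$ by $x$ at no cost. At any time $\ell$ may recharge the channel on-chain, adding an amount $F$ of funds to $b$, at cost $F+f_1$, where $f_1\in\mathbb{R}^+$ is a constant. The cost of an algorithm is the sum of its recharging costs. OFF is an optimal offline algorithm (it knows the whole sequence in advance); $\mathrm{Cost}_{\mathrm{OFF}}(X_t)$, $\mathrm{Cost}_{\mathrm{ON}}(X_t)$ denote costs. $A(X)$ denotes the total amount of funds OFF locks in the channel when its whole input is $X$; in this problem $A(X_i)=\sum_{j\le i}x_j$ for $X_i=(x_1,\dots,x_i)$. Algorithm ON: maintain $T$, initially $0$. When transaction $x_i$ arrives: if $A(X_i)>T$, set $T\leftarrow A(X_i)+f_1$ and recharge so that the total amount of funds put into the channel so far equals $T$. Then accept $x_i$. *)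

(* Defs.v *)
From mathcomp Require Import all_boot all_order all_algebra.
From mathcomp Require Import reals.

Set Implicit Arguments.
Unset Strict Implicit.
Unset Printing Implicit Defensive.

Import Order.TTheory GRing.Theory Num.Theory.
Local Open Scope ring_scope.

Section Channel.
Variable R : realType.

Inductive action := Recharge of R | Accept of R.

Definition schedule := seq action.

Implicit Types (s : schedule) (X : seq R).

(* [b] is the balance of the left user when the schedule starts. *)
Fixpoint valid (b : R) s : bool :=
  match s with
  | [::] => true
  | Recharge F :: s' => (0 < F) && valid (b + F) s'
  | Accept x :: s' => (x <= b) && valid (b - x) s'
  end.

Definition accepted s : seq R :=
  pmap (fun a => if a is Accept x then Some x else None) s.

(* There is no rejection: all of [X] is accepted, in order of arrival. *)
Definition feasible X s : bool := valid 0 s && (accepted s == X).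

Definition cost (f1 : R) s : R :=
  \sum_(a <- s) (if a is Recharge F then F + f1 else 0).

Definition funds s : R := \sum_(a <- s) (if a is Recharge F then F else 0).

Definition transactions X : bool := all (fun x => 0 < x) X.

(* For [0 < f1] such an [OFF] exists: recharge once, by the sum of [X],
   if [X] is nonempty.  Every
   such [OFF] satisfies [funds (OFF X) = \sum_(x <- X) x]. *)
Definition optimal_offline (f1 : R) (OFF : seq R -> schedule) : Prop :=
  forall X, transactions X ->
    feasible X (OFF X) /\
    forall s, feasible X s -> cost f1 (OFF X) <= cost f1 s.

(* Arguments of [on_run]: the current [T], the actions taken so far [s], the
   transactions already processed [past], and those still to arrive.  The
   parameter [A] is only ever evaluated on what has arrived. *)
Fixpoint on_run (f1 : R) (A : seq R -> R) (T : R) s (past future : seq R)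
    : schedule :=
  if future is x :: future' then
    let Xi := rcons past x in
    if T < A Xi then
      let T' := A Xi + f1 in
      on_run f1 A T' (s ++ [:: Recharge (T' - funds s); Accept x]) Xi future'
    else on_run f1 A T (s ++ [:: Accept x]) Xi future'
  else s.

(* [A Xi] is the amount of funds [OFF] locks on input [Xi]. *)
Definition ON (f1 : R) (OFF : seq R -> schedule) (X : seq R) : schedule :=
  on_run f1 (fun Xi => funds (OFF Xi)) 0 [::] [::] X.

(* Serving every transaction is part of being competitive: an algorithm that
   leaves transactions unpaid is not a solution of the problem. *)
Definition competitive (f1 : R) (OFF : seq R -> schedule) (c : R)
    (ALG : seq R -> schedule) : Prop :=
  forall X, transactions X ->
    feasible X (ALG X) /\ cost f1 (ALG X) <= c * cost f1 (OFF X).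

End Channel.

(* Main.v *)
Require Import Defs.
From mathcomp Require Import all_boot all_order all_algebra.
From mathcomp Require Import reals.
From mathcomp Require Import lra.

Import Order.TTheory GRing.Theory Num.Theory.
Local Open Scope ring_scope.

(** On a nonempty sequence [X], OFF recharges once, by the sum of [X], so it
    costs that sum plus [f1].  Each recharge of ON raises [T] by more than
    [f1], so the recharging fees paid by ON never exceed the funds [T] it has
    locked and ON costs at most [2 * T]; and [T] is at most the sum of [X]
    plus [f1]. *)

Section Schedules.
Variables (R : realType) (f1 : R).
Implicit Types (b x F T : R) (s : schedule R) (X : seq R).

Lemma funds_recharge F s : funds (Recharge F :: s) = F + funds s.
Proof. by rewrite /funds big_cons. Qed.

Lemma funds_accept x s : funds (Accept x :: s) = funds s.
Proof. by rewrite /funds big_cons add0r. Qed.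

Lemma funds_cat s1 s2 : funds (s1 ++ s2) = funds s1 + funds s2.
Proof. exact: big_cat. Qed.

Lemma cost_recharge F s : cost f1 (Recharge F :: s) = F + f1 + cost f1 s.
Proof. by rewrite /cost big_cons. Qed.

Lemma cost_accept x s : cost f1 (Accept x :: s) = cost f1 s.
Proof. by rewrite /cost big_cons add0r. Qed.

Lemma cost_cat s1 s2 : cost f1 (s1 ++ s2) = cost f1 s1 + cost f1 s2.
Proof. exact: big_cat. Qed.

Lemma accepted_cat s1 s2 : accepted (s1 ++ s2) = accepted s1 ++ accepted s2.
Proof. exact: pmap_cat. Qed.

Lemma valid_cat b s1 s2 :
  valid b (s1 ++ s2) =
  valid b s1 && valid (b + funds s1 - \sum_(x <- accepted s1) x) s2.
Proof.
elim: s1 b => [|[F|x] s1 IH] b /=.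
- by rewrite /funds !big_nil addr0 subr0.
- by rewrite IH funds_recharge addrA andbA.
- rewrite IH funds_accept big_cons andbA; congr (_ && valid _ _); lra.
Qed.

(** Every accept is covered by the current balance, so a nonnegative balance stays nonnegative to
    the end. *)
Lemma valid_funds b s :
  0 <= b -> valid b s -> \sum_(x <- accepted s) x <= b + funds s.
Proof.
elim: s b => [|[F|x] s IH] b b0 /=.
- by rewrite /funds !big_nil addr0.
- by case/andP=> F0 v; rewrite funds_recharge addrA; apply: IH v; lra.
- case/andP=> xb v; rewrite funds_accept big_cons.
  have := IH (b - x); rewrite subr_ge0 => /(_ xb v); lra.
Qed.

Lemma valid_cost b s : 0 <= f1 -> valid b s -> funds s <= cost f1 s.
Proof.
move=> f1_ge0; elim: s b => [|[F|x] s IH] b /=.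
- by rewrite /funds /cost !big_nil.
- by case/andP=> _ /IH; rewrite funds_recharge cost_recharge; lra.
- by case/andP=> _ /IH; rewrite funds_accept cost_accept.
Qed.

(** Positive funds force at least one recharge. The first one pays the fee [f1], and [valid_cost]
    bounds what follows it. *)
Lemma valid_cost_fee b s :
  0 <= f1 -> valid b s -> 0 < funds s -> funds s + f1 <= cost f1 s.
Proof.
move=> f1_ge0; elim: s b => [|[F|x] s IH] b /=.
- by rewrite /funds big_nil ltxx.
- case/andP=> _ /valid_cost -/(_ f1_ge0).
  by rewrite funds_recharge cost_recharge; lra.
- by case/andP=> _ /IH; rewrite funds_accept cost_accept.
Qed.

Lemma valid_accept_all X :
  transactions X -> valid (\sum_(x <- X) x) [seq Accept x | x <- X].
Proof.
elim: X => //= x X IH /andP[x0 X0]; rewrite big_cons addrC addrK IH // andbT.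
by rewrite lerDr big_seq sumr_ge0 // => y /(allP X0)/ltW.
Qed.

Lemma sum_gt0 X : transactions X -> X != [::] -> 0 < \sum_(x <- X) x.
Proof.
case: X => //= x X /andP[x0 X0] _; rewrite big_cons ltr_wpDr //.
by rewrite big_seq sumr_ge0 // => y /(allP X0)/ltW.
Qed.

(** The competitor that bounds the optimum from above. Nonemptiness makes its recharge positive, as
    [valid] demands. *)
Lemma feasible_recharge_once X :
  transactions X -> X != [::] ->
  feasible X (Recharge (\sum_(x <- X) x) :: [seq Accept x | x <- X]).
Proof.
move=> X0 Xn; rewrite /feasible /= sum_gt0 // add0r valid_accept_all //=.
by apply/eqP; elim: X {X0 Xn} => //= x X ->.
Qed.

Lemma cost_recharge_once X :
  cost f1 (Recharge (\sum_(x <- X) x) :: [seq Accept x | x <- X]) =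
  \sum_(x <- X) x + f1.
Proof. by rewrite cost_recharge /cost big_map big1_eq addr0. Qed.

(** A sandwich: the sum plus [f1] is at most [funds (OFF X) + f1], which is at most the cost of
    [OFF X], which is at most the cost of recharging once. Hence all are equal. *)
Lemma optimal_offline_funds_cost OFF X :
  0 <= f1 -> optimal_offline f1 OFF -> transactions X -> X != [::] ->
  funds (OFF X) = \sum_(x <- X) x /\ cost f1 (OFF X) = \sum_(x <- X) x + f1.
Proof.
move=> f1_ge0 opt X0 Xn; have [/andP[v /eqP acc] le] := opt X X0.
have := le _ (feasible_recharge_once _ X0 Xn); rewrite cost_recharge_once.
have := valid_funds _ _ (lexx 0) v; rewrite acc add0r => leX.
have := valid_cost_fee _ _ f1_ge0 v (lt_le_trans (sum_gt0 _ X0 Xn) leX).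
by split; lra.
Qed.

(** The hypotheses on [s] and [T] form the loop invariant, kept by induction on [future]. [A] is
    constrained on nonempty sequences only, since the run evaluates it just after an arrival. *)
Lemma on_run_feasible_cost A T s past future :
  0 <= f1 -> transactions (past ++ future) ->
  (forall X, transactions X -> X != [::] -> A X = \sum_(x <- X) x) ->
  valid 0 s -> accepted s = past -> funds s = T -> cost f1 s <= 2 * T ->
  T <= \sum_(x <- past) x + f1 ->
  feasible (past ++ future) (on_run f1 A T s past future) /\
  cost f1 (on_run f1 A T s past future) <=
    2 * (\sum_(x <- past ++ future) x + f1).
Proof.
move=> f1_ge0 + AE; elim: future T s past => [|x future IH] T s past /=.
  rewrite cats0 => _ v acc _ cT Tle; split; first by rewrite /feasible v acc /=.
  lra.
rewrite -cat_rcons => X0 v acc fs cT Tle.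
have Xi0 : transactions (rcons past x).
  by move: X0; rewrite /transactions all_cat => /andP[].
have x0 : 0 < x by move: Xi0; rewrite /transactions all_rcons => /andP[].
have sumE : \sum_(y <- rcons past x) y = \sum_(y <- past) y + x.
  by rewrite -cats1 big_cat big_seq1.
have -> : A (rcons past x) = \sum_(y <- past) y + x.
  by rewrite AE ?sumE // -size_eq0 size_rcons.
case: ltP => leT; apply: IH => //.
(* Since [T < A Xi], the recharge exceeds [f1], hence is positive; it lifts the balance to [x + f1],
   which covers [x]. *)
- rewrite valid_cat v acc fs /= andbT; apply/andP; split; lra.
- by rewrite accepted_cat acc /= cats1.
- by rewrite funds_cat fs funds_recharge funds_accept /funds big_nil; lra.
(* The fee [f1] is less than the increase of [T], so the cost grows by less than twice that
   increase. *)
- by rewrite cost_cat cost_recharge cost_accept fs {2}/cost big_nil; lra.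
- by rewrite sumE.
(* Without a recharge, [A Xi <= T] says exactly that the balance, [T] minus the past sum, covers
   [x]. *)
- by rewrite valid_cat v acc fs /= andbT; lra.
- by rewrite accepted_cat acc /= cats1.
- by rewrite funds_cat fs funds_accept /funds big_nil addr0.
- by rewrite cost_cat cost_accept {2}/cost big_nil addr0.
- by rewrite sumE; lra.
Qed.

End Schedules.

Theorem theorem1 (R : realType) (f1 : R) (OFF : seq R -> schedule R)
    (f1_gt0 : 0 < f1) (OFF_opt : optimal_offline f1 OFF) :
  competitive f1 OFF 2 (ON f1 OFF).
Proof.
have f1_ge0 := ltW f1_gt0.
(* The empty sequence is separate because no fee is forced there: ON pays nothing, and the cost of
   OFF is nonnegative. *)
move=> X X0; have [-> | Xn] := eqVneq X [::].
  have [/andP[v /eqP acc] _] := OFF_opt [::] isT.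
  split; first by rewrite /feasible /=.
  have := valid_funds _ _ _ (lexx 0) v; rewrite acc big_nil add0r.
  have := valid_cost _ _ _ _ f1_ge0 v.
  by rewrite /ON /= {2}/cost big_nil; lra.
have [_ ->] := optimal_offline_funds_cost _ _ _ _ f1_ge0 OFF_opt X0 Xn.
(* The bound on ON is now literally twice the optimal cost; the invariant holds at the start with
   [T = 0] and an empty schedule. *)
apply: (on_run_feasible_cost _ _ _ _ _ [::] X) => //.
- move=> Y Y0 Yn.
  by have [] := optimal_offline_funds_cost _ _ _ _ f1_ge0 OFF_opt Y0 Yn.
- by rewrite /funds big_nil.
- by rewrite /cost big_nil mulr0.
- by rewrite big_nil add0r.
Qed.
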